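(* Let $P$ be a partial stochastic matrix of order $n$ for which there is a stochastic completion having a single essential class of indices. Then there is a $T \in SC(P)$ such that: (i) $T$ has a single essential class; (ii) $\mathcal{K}(T) = m(P)$; and (iii) for each $j = 1, \ldots, n$ there is at most one $k$ such that the $(j,k)$ entry of $P$ is unspecified and $t_{j,k} > 0$.
   Context: A stochastic matrix is a square, entrywise nonnegative real matrix each of whose row sums equals $1$. A partial matrix is one in which some entries are specified and the others are not; a completion is obtained by assigning values to all unspecified entries. A partial stochastic matrix is a partial matrix $P$ such that: (i) $P$ is square; (ii) all specified entries are nonnegative; (iii) in each row the sum of the specified entries is at most $1$, and it equals $1$ for any fully specified row; (iv) any row whose specified entries sum to $1$ is fully specified; (v) any row that is not fully specified contains at least two unspecified entries. $SC(P)$ denotes the set of all completions of $P$ that are stochastic matrices. The directed graph of an $n\times n$ stochastic matrix $T=[t_{i,j}]$ has vertices $1,\ldots,n$ and an arc $i\to j$ iff $t_{i,j}>0$. An index $j$ is essential if whenever there is a walk from $j$ to $k$ there is also a walk from $k$ to $j$. The essential indices are partitioned into essential classes: subsets within which any index can be reached from any other, and from which no index outside can be reached. $T$ has a single essential class if and only if $1$ is an algebraically simple eigenvalue of $T$. For a stochastic matrix $T$ of order $n$ with a single essential class and eigenvalues $1=\lambda_1,\lambda_2,\ldots,\lambda_n$ (with algebraic multiplicity), Kemeny's constant is $\mathcal{K}(T)=\sum_{j=2}^n \frac{1}{1-\lambda_j}$. If some stochastic completion of $P$ has a single essential class, $m(P)=\inf\{\mathcal{K}(T) : T\in SC(P),\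 T \text{ has a single essential class}\}$. *)

(* Defs.v *)
From mathcomp Require Export all_boot all_order all_algebra.
From mathcomp Require Export classical_sets reals.
From mathcomp Require Export complex.

Set Implicit Arguments.
Unset Strict Implicit.
Unset Printing Implicit Defensive.

Import Order.TTheory GRing.Theory Num.Theory.
Local Open Scope ring_scope.
Local Open Scope complex_scope.

Definition stochastic (R : realType) (n : nat) (T : 'M[R]_n) : Prop :=
  (forall i j, 0 <= T i j) /\ (forall i, \sum_j T i j = 1).

(* A partial matrix of order n is a P : 'M[option R]_n, with [None] marking the
   unspecified entries. *)
Definition unspecified (R : realType) (n : nat) (P : 'M[option R]_n)
  (i : 'I_n) : {set 'I_n} := [set k | P i k == None].

Definition fully_specified (R : realType) (n : nat) (P : 'M[option R]_n)
  (i : 'I_n) : bool := unspecified P i == finset.set0.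

(* [odflt 0] makes the unspecified entries contribute nothing. *)
Definition specified_sum (R : realType) (n : nat) (P : 'M[option R]_n)
  (i : 'I_n) : R := \sum_k odflt 0 (P i k).

Record partial_stochastic (R : realType) (n : nat) (P : 'M[option R]_n)
  : Prop := PartialStochastic {
  ps_ge0 : forall i j x, P i j = Some x -> 0 <= x;
  ps_sum_le1 : forall i, specified_sum P i <= 1;
  ps_sum_full : forall i, fully_specified P i -> specified_sum P i = 1;
  ps_full : forall i, specified_sum P i = 1 -> fully_specified P i;
  ps_unspecified_ge2 :
    forall i, ~~ fully_specified P i -> (2 <= #|unspecified P i|)%N
}.

Definition completion (R : realType) (n : nat) (P : 'M[option R]_n)
  (T : 'M[R]_n) : Prop := forall i j x, P i j = Some x -> T i j = x.

Definition SC (R : realType) (n : nat) (P : 'M[option R]_n) : set 'M[R]_n :=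
  [set T | completion P T /\ stochastic T]%classic.

Definition arc (R : realType) (n : nat) (T : 'M[R]_n) : rel 'I_n :=
  fun i j => 0 < T i j.

Definition walk (R : realType) (n : nat) (T : 'M[R]_n) : rel 'I_n :=
  connect (arc T).

Definition essential (R : realType) (n : nat) (T : 'M[R]_n) (j : 'I_n) : bool :=
  [forall k, walk T j k ==> walk T k j].

Definition essential_class (R : realType) (n : nat) (T : 'M[R]_n)
  (C : {set 'I_n}) : bool :=
  [&& C != finset.set0,
      [forall i in C, essential T i],
      [forall i in C, forall j in C, walk T i j] &
      [forall i in C, forall j, (j \notin C) ==> ~~ walk T i j]].

Definition single_essential_class (R : realType) (n : nat) (T : 'M[R]_n)
  : Prop := #|[set C : {set 'I_n} | essential_class T C]| = 1%N.

(* The complex eigenvalues of T, listed with algebraic multiplicity. *)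
Definition eigenvalues (R : realType) (n : nat) (T : 'M[R]_n) : seq R[i] :=
  sval (closed_field_poly_normal (char_poly (map_mx (real_complex R) T))).

Lemma eigenvaluesP (R : realType) (n : nat) (T : 'M[R]_n) :
  char_poly (map_mx (real_complex R) T)
  = \prod_(z <- eigenvalues T) ('X - z%:P).
Proof.
rewrite /eigenvalues; case: closed_field_poly_normal => r /= {1}->.
by rewrite (monicP (char_poly_monic _)) scale1r.
Qed.

(* [rem 1] drops a single occurrence of the eigenvalue 1. *)
Definition kemeny_sum (R : realType) (n : nat) (T : 'M[R]_n) : R[i] :=
  \sum_(z <- rem 1 (eigenvalues T)) (1 - z)^-1.

Definition kemeny (R : realType) (n : nat) (T : 'M[R]_n) : R :=
  complex.Re (kemeny_sum T).

Lemma kemenyE (R : realType) (n : nat) (T : 'M[R]_n) :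
  (kemeny T)%:C = kemeny_sum T.
Proof.
suff h : (kemeny_sum T)^* = kemeny_sum T.
  rewrite /kemeny; case: (kemeny_sum T) h => a b /= [] /eqP.
  by rewrite eqNr => /eqP ->.
have p : perm_eq (map conjc (eigenvalues T)) (eigenvalues T).
  apply: prod_XsubC_eq; rewrite big_map -eigenvaluesP.
  have -> : char_poly (map_mx (real_complex R) T)
      = map_poly conjc (char_poly (map_mx (real_complex R) T)).
    rewrite map_char_poly; congr char_poly; apply/matrixP => i j.
    by rewrite !mxE /= oppr0.
  rewrite eigenvaluesP rmorph_prod.
  by apply: eq_bigr => z _; rewrite rmorphB /= map_polyX map_polyC.
have q : perm_eq (map conjc (rem 1 (eigenvalues T))) (rem 1 (eigenvalues T)).
  case: (boolP (1 \in eigenvalues T)) => h1; last by rewrite rem_id.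
  have e := perm_to_rem h1.
  rewrite -(perm_cons 1); apply: perm_trans (perm_trans p e).
  by rewrite -{1}(@conjc1 R) -map_cons; apply: perm_map; rewrite perm_sym.
rewrite /kemeny_sum -[in RHS](perm_big _ q) big_map rmorph_sum.
by apply: eq_bigr => z _; rewrite fmorphV rmorphB rmorph1.
Qed.

Definition kemeny_inf (R : realType) (n : nat) (P : 'M[option R]_n) : R :=
  inf [set kemeny T | T in
        [set T : 'M[R]_n | SC P T /\ single_essential_class T]]%classic.

(* Main.v *)
Require Import Defs.
From mathcomp Require Import polyrcf boolp.
Import Order.TTheory GRing.Theory Num.Theory.
Local Open Scope ring_scope.

(** Write the characteristic polynomial of a stochastic matrix T as
    [('X - 1) * q], where [q] is [deflated_char_poly T].  The logarithmic
    derivative of [q] at 1 is the sum of the [1 / (1 - z)] over the remaining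
    eigenvalues, so that Kemeny's constant is the quotient [q'(1) / q(1)]
    ([kemeny_deflated]), and [q(1) != 0] characterises the matrices having a
    single essential class ([single_essential_class_deflated]).

    The characteristic polynomial is affine in each row of T separately, and
    so is [q] ([deflated_row_affine]).  A row of a stochastic completion of P
    is a convex combination of the rows in which the whole missing mass is put
    on one unspecified entry.  Along this simplex Kemeny's constant is a
    quotient of two affine functions, and such a quotient is at least its value
    at some vertex ([exists_ratio_le_mediant]).  The only danger is a vertex
    where the denominator [q(1)] vanishes, that is, where the single essential
    class is lost: it does no harm as long as the numerator [q'(1)] is
    nonnegative there.  This holds because no stochastic matrix has a real
    eigenvalue above 1: [q] is positive on the right of 1, hence [q(1) >= 0],
    and [q'(1) >= 0] when [q(1) = 0].

    Moving one row after the other to a vertex never increases Kemeny's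
    constant ([vertex_completion_kemeny_le]).  There are finitely many vertex
    completions, so the best of them attains the infimum. *)

Set Implicit Arguments.
Unset Strict Implicit.
Unset Printing Implicit Defensive.

(** * Real polynomials *)

Lemma horner_ge0_left_end (R : rcfType) (r : {poly R}) (a : R) :
  (forall x, a < x -> 0 <= r.[x]) -> 0 <= r.[a].
Proof.
move=> r_ge0; rewrite leNgt; apply/negP => ra_lt0.
have [|d d_gt0 near_a] := @poly_cont _ a r (- r.[a]); first by rewrite oppr_gt0.
have lt_a : a < a + d / 2 by rewrite ltrDl divr_gt0.
have /near_a : `|a + d / 2 - a| < d.
  rewrite addrAC subrr add0r gtr0_norm ?divr_gt0 // ltr_pdivrMr //.
  by rewrite mulr_natr mulr2n ltrDl.
move=> /ltr_normlW; rewrite ltrBlDr addNr ltNge.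
by rewrite r_ge0.
Qed.

Lemma monic_horner_gt0 (R : rcfType) (r : {poly R}) (a : R) :
  r \is monic -> (forall x, a < x -> ~~ root r x) ->
  forall x, a < x -> 0 < r.[x].
Proof.
move=> /monicP r_monic noroot x lt_ax.
have [|b r_gt0] := @poly_pinfty_gt_lc _ r; first by rewrite r_monic.
have rb_gt0 : 0 < r.[Num.max b x].
  by rewrite (lt_le_trans _ (r_gt0 _ _)) ?r_monic // le_max lexx.
rewrite ltNge; apply/negP => rx_le0.
have le_x : x <= Num.max b x by rewrite le_max lexx orbT.
have [z /andP[le_xz _] rz] :=
  polyrcf.poly_ivt le_x (mulr_le0_ge0 rx_le0 (ltW rb_gt0)).
by move: rz; apply/negP/noroot/(lt_le_trans lt_ax).
Qed.

Lemma horner_deriv_prod_XsubC (F : fieldType) (s : seq F) (a : F) :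
  a \notin s ->
  (\prod_(z <- s) ('X - z%:P))^`().[a]
  = (\prod_(z <- s) ('X - z%:P)).[a] * \sum_(z <- s) (a - z)^-1.
Proof.
elim: s => [|z s IH]; first by rewrite !big_nil derivC hornerC mulr0.
rewrite inE negb_or => /andP[az a_s].
rewrite !big_cons derivM derivXsubC mul1r hornerD !hornerM hornerXsubC IH //.
rewrite mulrDr mulrA; congr (_ + _).
by rewrite mulrAC mulfV ?mul1r // subr_eq0.
Qed.

(** * The deflated characteristic polynomial *)

Definition deflated_char_poly (F : fieldType) (n : nat) (T : 'M[F]_n)
  : {poly F} :=
  char_poly T %/ ('X - 1%:P).

Section Stochastic.
Variables (R : realType) (n : nat) (T : 'M[R]_n.+1).
Hypothesis T_st : stochastic T.

Local Notation q := (deflated_char_poly T).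

(** The all-ones column is an eigenvector of [char_poly_mx T] for ['X - 1];
    multiplying it by the adjugate extracts the factor ['X - 1] from the
    determinant and leaves a row sum of the adjugate as cofactor. *)
Lemma char_poly_stochastic k :
  char_poly T = (\sum_j cofactor (char_poly_mx T) j k) * ('X - 1%:P).
Proof.
have eigen1 : char_poly_mx T *m const_mx 1 = const_mx ('X - 1%:P) :> 'cV_n.+1.
  apply/matrixP => i j; rewrite !mxE.
  under eq_bigr do rewrite !mxE mulr1.
  rewrite sumrB -(rmorph_sum polyC) T_st.2 (bigD1 i) //= eqxx big1 ?addr0 //.
  by move=> l /negPf; rewrite eq_sym => ->.
have /matrixP/(_ k 0) : \adj (char_poly_mx T) *m (char_poly_mx T *m const_mx 1)
    = \adj (char_poly_mx T) *m const_mx ('X - 1%:P) :> 'cV_n.+1 by rewrite eigen1.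
rewrite mulmxA mul_adj_mx mul_scalar_mx !mxE mulr1 /char_poly => ->.
by rewrite mulr_suml; apply: eq_bigr => j _; rewrite !mxE.
Qed.

Lemma deflated_char_polyE k : q = \sum_j cofactor (char_poly_mx T) j k.
Proof.
by rewrite /deflated_char_poly (char_poly_stochastic k) mulpK ?polyXsubC_eq0.
Qed.

Lemma char_poly_deflated : char_poly T = q * ('X - 1%:P).
Proof. by rewrite (deflated_char_polyE 0) -char_poly_stochastic. Qed.

(** A left eigenvector [v] for [x] satisfies [x * |v| <= |v|] in the sum norm,
    because right multiplication by T does not increase that norm. *)
Lemma stochastic_no_root_gt1 x : 1 < x -> ~~ root (char_poly T) x.
Proof.
move=> x_gt1; rewrite -eigenvalue_root_char; apply/eigenvalueP => -[v vT v0].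
have norm_le : x * \sum_j `|v 0 j| <= \sum_j `|v 0 j|.
  have rowsum i : `|v 0 i| = \sum_j `|v 0 i| * T i j.
    by rewrite -mulr_sumr T_st.2 mulr1.
  rewrite mulr_sumr (eq_bigr _ (fun i _ => rowsum i)) exchange_big /=.
  apply: ler_sum => j _; have /matrixP/(_ 0 j) := vT; rewrite !mxE.
  move=> vTj; rewrite -[x in x * _]gtr0_norm ?(lt_trans ltr01) // -normrM -vTj.
  apply: le_trans (ler_norm_sum _ _ _) _; apply: ler_sum => i _.
  by rewrite normrM (ger0_norm (T_st.1 _ _)).
have norm0 : \sum_j `|v 0 j| = 0.
  apply/eqP; rewrite eq_le sumr_ge0 // andbT.
  rewrite -(pmulr_rle0 _ (_ : 0 < x - 1)) ?subr_gt0 //.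
  by rewrite mulrBl mul1r subr_le0.
case/negP: v0; apply/eqP/rowP => j; rewrite mxE; apply/normr0_eq0.
by apply: (psumr_eq0P _ norm0).
Qed.

Lemma deflated_gt0 x : 1 < x -> 0 < q.[x].
Proof.
move=> x_gt1.
have := monic_horner_gt0 (char_poly_monic T) stochastic_no_root_gt1 x_gt1.
by rewrite char_poly_deflated hornerM hornerXsubC pmulr_lgt0 ?subr_gt0.
Qed.

Lemma deflated1_ge0 : 0 <= q.[1].
Proof. by apply: horner_ge0_left_end => x /deflated_gt0/ltW. Qed.

(** If [q(1) = 0] then [q = s * ('X - 1)] where [s] is still positive on the
    right of 1, and [q'(1) = s(1)]. *)
Lemma deriv_deflated1_ge0 : q.[1] = 0 -> 0 <= q^`().[1].
Proof.
move=> /rootP/factor_theorem[s qE].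
have -> : q^`().[1] = s.[1].
  rewrite qE derivM derivXsubC mulr1 hornerD hornerM hornerXsubC.
  by rewrite subrr mulr0 add0r.
apply: horner_ge0_left_end => x x_gt1; have := deflated_gt0 x_gt1.
by rewrite qE hornerM hornerXsubC pmulr_lgt0 ?subr_gt0 // => /ltW.
Qed.

(** Dropping one eigenvalue 1 from the list of the roots of the characteristic
    polynomial amounts to dividing by ['X - 1]; since [q(1) != 0], no other
    eigenvalue is 1 and the logarithmic derivative of [q] at 1 makes sense. *)
Lemma kemeny_deflated : q.[1] != 0 -> kemeny T = q^`().[1] / q.[1].
Proof.
move=> q1; pose f : {rmorphism R -> R[i]%C} := real_complex R.
have charE : char_poly (map_mx f T) = map_poly f q * ('X - 1%:P).
  rewrite -map_char_poly char_poly_deflated rmorphM rmorphB /=.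
  by rewrite map_polyX map_polyC.
have one_eigen : 1 \in eigenvalues T.
  by rewrite -root_prod_XsubC -eigenvaluesP charE rootM root_XsubC eqxx orbT.
have qE : map_poly f q = \prod_(z <- rem 1 (eigenvalues T)) ('X - z%:P).
  apply: (@mulIf _ ('X - 1%:P)); first by rewrite polyXsubC_eq0.
  rewrite -charE eigenvaluesP (perm_big _ (perm_to_rem one_eigen)) big_cons.
  by rewrite mulrC.
have f1 : f 1 = 1 by apply: rmorph1.
have not_one : 1 \notin rem 1 (eigenvalues T).
  rewrite -root_prod_XsubC -qE rootE -f1 horner_map.
  by rewrite fmorph_eq0.
have kE : f (kemeny T) = f (q^`().[1] / q.[1]).
  rewrite [LHS]kemenyE fmorph_div -!horner_map -deriv_map.
  rewrite qE f1 horner_deriv_prod_XsubC //.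
  rewrite mulrAC mulfV ?mul1r //.
  by rewrite -qE -f1 horner_map fmorph_eq0.
by apply: (fmorph_inj f kE).
Qed.

Lemma deflated1E k : q.[1] = \sum_j cofactor (1%:M - T) j k.
Proof.
rewrite (deflated_char_polyE k) -/(horner_eval 1 _) rmorph_sum /=.
apply: eq_bigr => j _; rewrite -cofactor_map_mx; congr cofactor.
apply/matrixP => a b; rewrite !mxE /= /horner_eval hornerD hornerN hornerC.
by rewrite hornerMn hornerX.
Qed.

(** By cofactor expansion, [q(1)] is the determinant of the matrix [1 - T] with
    one column replaced by ones.  A row vector kills that matrix iff its entries
    sum to 0 and it is fixed by T in the other columns; it is then fixed in the
    replaced column too, since T preserves the total mass. *)
Lemma deflated1_eq0P :
  reflect (exists2 u : 'rV[R]_n.+1, u != 0 & u *m T = u /\ \sum_j u 0 j = 0)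
          (q.[1] == 0).
Proof.
pose M := \matrix_(i, j) (if j == 0 then 1 else (1%:M - T) i j) : 'M[R]_n.+1.
have uM (u : 'rV_n.+1) j : (u *m M) 0 j
    = if j == 0 then \sum_i u 0 i else u 0 j - (u *m T) 0 j.
  rewrite mxE; case: (eqVneq j 0) => [->|j0].
    by apply: eq_bigr => i _; rewrite mxE mulr1.
  transitivity ((u *m (1%:M - T)) 0 j); last by rewrite mulmxBr mulmx1 !mxE.
  by rewrite mxE; apply: eq_bigr => i _; rewrite mxE (negPf j0).
have -> : q.[1] = \det M.
  rewrite (deflated1E 0) (expand_det_col M 0); apply: eq_bigr => i _.
  rewrite mxE eqxx mul1r /cofactor; congr (_ * \det _).
  by apply/matrixP => a b; rewrite !mxE [_ == 0]eq_sym (negPf (neq_lift _ _)).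
apply: (iffP det0P) => -[u u0].
  move=> uM0.
  have sum0 : \sum_i u 0 i = 0.
    by have := uM u 0; rewrite uM0 mxE eqxx.
  have fixed j : j != 0 -> u 0 j = (u *m T) 0 j.
    move=> j0; have := uM u j; rewrite uM0 mxE (negPf j0).
    by move/esym/eqP; rewrite subr_eq0 => /eqP.
  exists u => //; split=> //.
  have mass : \sum_j (u *m T) 0 j = \sum_j u 0 j.
    under eq_bigr do rewrite mxE.
    rewrite exchange_big; apply: eq_bigr => i _.
    by rewrite -mulr_sumr T_st.2 mulr1.
  apply/rowP => j; have [->|/fixed->//] := eqVneq j 0.
  move: mass; rewrite (bigD1 0) //= [in RHS](bigD1 0) //=.
  by rewrite -(eq_bigr _ fixed) => /addIr.
move=> [uT sum0]; exists u => //; apply/rowP => j.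
by rewrite uM uT sum0 subrr mxE if_same.
Qed.

End Stochastic.

(** * Essential classes and fixed row vectors *)

Section Classes.
Variables (R : realType) (n : nat) (T : 'M[R]_n).

Definition forward_closed (C : {set 'I_n}) : Prop :=
  forall i j, i \in C -> arc T i j -> j \in C.

Lemma forward_closed_walk C i j :
  forward_closed C -> i \in C -> walk T i j -> j \in C.
Proof.
move=> C_cl iC /connectP[p]; elim: p i iC => [|k p IH] i iC /=.
  by move=> _ ->.
by move=> /andP[/(C_cl _ _ iC)/IH]; apply.
Qed.

Lemma essential_classP C :
  reflect [/\ C != finset.set0, forward_closed C &
              {in C &, forall i j, walk T i j}] (essential_class T C).
Proof.
apply: (iffP and4P) => [[C0 _ /forall_inP conn /forall_inP out] | [C0 C_cl conn]].
  split=> // [i j iC ij | i j iC jC]; last by have /forall_inP := conn i iC; apply.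
  apply: contraT => jC; have /forallP/(_ j) := out i iC.
  by rewrite jC /walk connect1.
split=> //.
- apply/forall_inP => i iC; apply/forallP => k; apply/implyP => ik.
  exact/conn/iC/(forward_closed_walk C_cl iC ik).
- by apply/forall_inP => i iC; apply/forall_inP => j jC; apply: conn.
apply/forall_inP => i iC; apply/forallP => j; apply/implyP.
by apply: contra; apply: forward_closed_walk.
Qed.

(** The states reachable from [x] form an essential class as soon as [x] in the
    closed set minimises the number of reachable states. *)
Lemma forward_closed_essential C :
  C != finset.set0 -> forward_closed C ->
  exists2 K : {set 'I_n}, essential_class T K & K \subset C.
Proof.
move=> /set0Pn[x0 x0C] C_cl; pose reach x := [set y | walk T x y].
have reach_cl x : forward_closed (reach x).
  by move=> i j; rewrite !inE => xi /connect1; apply: connect_trans.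
case: (arg_minnP (fun x => #|reach x|) x0C) => x xC x_min.
exists (reach x); last first.
  by apply/fintype.subsetP => y; rewrite inE; apply: forward_closed_walk.
apply/essential_classP; split=> [||i j].
  by apply/set0Pn; exists x; rewrite inE /walk connect0.
  exact: reach_cl.
rewrite !inE => xi xj; suff: x \in reach i.
  by rewrite inE => ix; apply: connect_trans ix xj.
have sub : reach i \subset reach x.
  by apply/fintype.subsetP => y; rewrite !inE; apply: connect_trans.
have /eqP -> : reach i == reach x.
  by rewrite eqEcard sub x_min //; apply: forward_closed_walk xi.
by rewrite inE /walk connect0.
Qed.

Lemma essential_class_meet C K i :
  essential_class T C -> essential_class T K -> i \in C -> i \in K -> C = K.
Proof.
move=> /essential_classP[_ C_cl C_conn] /essential_classP[_ K_cl K_conn] iC iK.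
apply/setP => j; apply/idP/idP => [jC|jK].
  by apply: (forward_closed_walk K_cl iK); apply: C_conn.
by apply: (forward_closed_walk C_cl iC); apply: K_conn.
Qed.

(** Replace the rows of [1 - T] outside of C by those of the identity.  The
    indicator of C is in the right kernel of the resulting matrix, which
    therefore has a nonzero left kernel; the identity rows force the vectors of
    the latter to vanish outside of C. *)
Lemma fixed_vector_closed C :
  stochastic T -> C != finset.set0 -> forward_closed C ->
  exists u : 'rV[R]_n,
    [/\ u != 0, u *m T = u & forall j, j \notin C -> u 0 j = 0].
Proof.
move=> T_st /set0Pn[x xC] C_cl.
have outT i j : i \in C -> j \notin C -> T i j = 0.
  move=> iC jC; apply/eqP; rewrite eq_le T_st.1 andbT leNgt.
  by apply: contra jC; apply: C_cl.
pose A := \matrix_(i, j) (if i \in C then (1%:M - T) i j else (i == j)%:R) : 'M[R]_n.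
have detA : \det A = 0.
  apply/eqP; rewrite -det_tr; apply/det0P.
  exists (\row_j (j \in C)%:R).
    by apply/eqP => /rowP/(_ x); rewrite !mxE xC => /eqP; rewrite oner_eq0.
  apply/rowP => i; rewrite !mxE.
  under eq_bigr do rewrite !mxE.
  have [iC|iC] := boolP (i \in C).
    transitivity (\sum_j (1%:M - T) i j).
      apply: eq_bigr => j _.
      have [jC|jC] := boolP (j \in C); rewrite ?mul1r ?mxE //.
      by rewrite outT // mul0r subr0; case: eqVneq => // eij; rewrite -eij iC in jC.
    under eq_bigr do rewrite !mxE.
    rewrite sumrB T_st.2 (bigD1 i) //= eqxx big1 ?addr0 ?subrr //.
    by move=> j /negPf; rewrite eq_sym => ->.
  rewrite big1 // => j _; case: eqVneq => [<-|]; last by rewrite mulr0.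
  by rewrite (negPf iC) mul0r.
have /det0P[u u0 uA] : \det A == 0 by rewrite detA.
have u_out j : j \notin C -> u 0 j = 0.
  move=> jC; have /rowP/(_ j) := uA; rewrite !mxE (bigD1 j) //= mxE (negPf jC).
  rewrite eqxx mulr1 big1 ?addr0 // => i ij; rewrite mxE (negPf ij) mulr0n.
  have [iC|_] := boolP (i \in C); last by rewrite mulr0.
  by rewrite !mxE (negPf ij) outT // subr0 mulr0.
exists u; split=> //; apply/eqP; rewrite eq_sym -subr_eq0; apply/eqP.
rewrite -{1}[u]mulmx1 -mulmxBr -[RHS]uA; apply/rowP => j; rewrite !mxE.
apply: eq_bigr => i _; rewrite [A i j]mxE.
by have [//|iC] := boolP (i \in C); rewrite u_out // !mul0r.
Qed.

(** If [u] is fixed then so is [|u|]: the triangle inequality gives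
    [|u| <= |u| T] entrywise, and both sides have the same total mass.  Hence
    [|u| + u], which is nonnegative and has the same positive entries as [u], is
    fixed, and mass can only flow from positive entries to positive entries. *)
Lemma fixed_vector_pos_closed (u : 'rV[R]_n) :
  stochastic T -> u *m T = u -> forward_closed [set j | 0 < u 0 j].
Proof.
move=> T_st uT.
have uTE j : u 0 j = \sum_i u 0 i * T i j by rewrite -{1}uT mxE.
have norm_le j : `|u 0 j| <= \sum_i `|u 0 i| * T i j.
  rewrite {1}uTE; apply: le_trans (ler_norm_sum _ _ _) _.
  by apply: ler_sum => i _; rewrite normrM (ger0_norm (T_st.1 _ _)).
have mass : \sum_j (\sum_i `|u 0 i| * T i j - `|u 0 j|) = 0.
  rewrite sumrB exchange_big; apply/eqP; rewrite subr_eq0; apply/eqP.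
  by apply: eq_bigr => i _; rewrite -mulr_sumr T_st.2 mulr1.
have normE j : `|u 0 j| = \sum_i `|u 0 i| * T i j.
  apply/esym/eqP; rewrite -subr_eq0; apply/eqP.
  by apply: (psumr_eq0P _ mass) => // k _; rewrite subr_ge0.
move=> i j; rewrite !inE => ui ij.
have : 0 < `|u 0 j| + u 0 j.
  rewrite normE uTE -big_split /= (bigD1 i) //= ltr_pwDl //.
    by rewrite -mulrDl mulr_gt0 // addr_gt0 // normr_gt0 gt_eqF.
  apply: sumr_ge0 => k _; rewrite -mulrDl mulr_ge0 ?T_st.1 //.
  by rewrite -lerBlDr sub0r -normrN ler_norm.
by have [u_gt0 _|u_le0] := ltP 0 (u 0 j); rewrite // ler0_norm // addNr ltxx.
Qed.

Lemma exists_pos_of_sum0 (u : 'rV[R]_n) :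
  u != 0 -> \sum_j u 0 j = 0 -> [set j | 0 < u 0 j] != finset.set0.
Proof.
move=> u0 sum0; apply: contra u0 => /eqP/setP no_pos.
have u_le0 j : 0 <= - u 0 j.
  by rewrite oppr_ge0 leNgt; have := no_pos j; rewrite !inE => ->.
apply/eqP/rowP => j; rewrite mxE; apply/eqP; rewrite -oppr_eq0; apply/eqP.
have Nsum0 : \sum_j - u 0 j = 0 by rewrite sumrN sum0 oppr0.
by apply: (psumr_eq0P _ Nsum0).
Qed.

End Classes.

(** If [q(1) = 0], the positive and the negative parts of a fixed vector of mass
    0 sit on two disjoint closed sets, each containing an essential class.
    Conversely, two essential classes carry independent fixed vectors, and some
    nonzero combination of them has mass 0. *)
Lemma single_essential_class_deflated (R : realType) (n : nat) (T : 'M[R]_n.+1) :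
  stochastic T ->
  single_essential_class T <-> (deflated_char_poly T).[1] != 0.
Proof.
move=> T_st; split.
  move=> /eqP/cards1P[K classK]; apply/negP => /(deflated1_eq0P T_st)[u u0 [uT sum0]].
  have eqK C : essential_class T C -> C = K.
    by move=> C_cl; apply/set1P; rewrite -classK inE.
  have [C1 C1e /fintype.subsetP C1pos] := forward_closed_essential
    (exists_pos_of_sum0 u0 sum0) (fixed_vector_pos_closed T_st uT).
  have Nu0 : - u != 0 by rewrite oppr_eq0.
  have Nsum0 : \sum_j (- u) 0 j = 0.
    by under eq_bigr do rewrite mxE; rewrite sumrN sum0 oppr0.
  have NuT : - u *m T = - u by rewrite mulNmx uT.
  have [C2 C2e /fintype.subsetP C2neg] := forward_closed_essential
    (exists_pos_of_sum0 Nu0 Nsum0) (fixed_vector_pos_closed T_st NuT).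
  have /essential_classP[/set0Pn[i iC1] _ _] := C1e.
  have := C1pos i iC1; rewrite (eqK _ C1e) -(eqK _ C2e) in iC1.
  have := C2neg i iC1; rewrite !inE mxE oppr_gt0 => /ltW.
  by rewrite leNgt => /negPf->.
move=> q1.
have [|| K Ke _] := @forward_closed_essential _ _ T finset.setT.
- by apply/set0Pn; exists 0; rewrite inE.
- by move=> i j _ _; rewrite inE.
apply/eqP/cards1P; exists K; apply/setP => C; rewrite !inE.
apply/idP/eqP => [Ce|->//]; apply/eqP; apply: contraNT q1 => CK.
have /essential_classP[C0 C_cl _] := Ce.
have /essential_classP[K0 K_cl _] := Ke.
have [u [u0 uT u_out]] := fixed_vector_closed T_st C0 C_cl.
have [v [v0 vT v_out]] := fixed_vector_closed T_st K0 K_cl.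
apply/(deflated1_eq0P T_st).
pose su := \sum_j u 0 j; pose sv := \sum_j v 0 j.
have [su0|su0] := eqVneq su 0; first by exists u.
exists (sv *: u - su *: v); last first.
  split; first by rewrite mulmxBl -!scalemxAl uT vT.
  under eq_bigr do rewrite !mxE.
  rewrite sumrB -!mulr_sumr -/su -/sv.
  by rewrite mulrC subrr.
apply: contra v0 => /eqP uv0; apply/eqP/rowP => j; rewrite [RHS]mxE.
have [jK|jK] := boolP (j \in K); last exact: v_out.
have jC : j \notin C.
  apply: contraNN CK => jC; apply/eqP.
  exact: essential_class_meet Ce Ke jC jK.
have /rowP/(_ j) := uv0; rewrite !mxE u_out // mulr0 sub0r.
by move/eqP; rewrite oppr_eq0 mulf_eq0 (negPf su0) => /eqP.
Qed.

(** * Affine dependence on a row *)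

(** Expand every determinant along row [i]: the cofactors do not see that row. *)
Lemma char_poly_row_affine (F : comNzRingType) (n : nat) (I : finType)
    (T : 'M[F]_n) (S : I -> 'M[F]_n) (c : I -> F) (i : 'I_n) :
  \sum_v c v = 1 ->
  (forall v a b, a != i -> S v a b = T a b) ->
  (forall b, T i b = \sum_v c v * S v i b) ->
  char_poly T = \sum_v c v *: char_poly (S v).
Proof.
move=> c1 S_off T_row; rewrite /char_poly.
under eq_bigr do rewrite (expand_det_row _ i) scaler_sumr.
rewrite (expand_det_row _ i) exchange_big; apply: eq_bigr => j _ /=.
have cofE v : cofactor (char_poly_mx (S v)) i j = cofactor (char_poly_mx T) i j.
  congr (_ * \det _); apply/matrixP => a b.
  by rewrite !mxE S_off // eq_sym neq_lift.
under eq_bigr do rewrite cofE scalerAl.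
rewrite -mulr_suml; congr (_ * _); rewrite !mxE.
under eq_bigr do rewrite !mxE scalerBr -[_ *: _%:P]mul_polyC -polyCM.
rewrite sumrB -scaler_suml c1 scale1r T_row rmorph_sum /=; congr (_ - _).
Qed.

Lemma deflated_row_affine (F : fieldType) (n : nat) (I : finType)
    (T : 'M[F]_n) (S : I -> 'M[F]_n) (c : I -> F) (i : 'I_n) :
  \sum_v c v = 1 ->
  (forall v a b, a != i -> S v a b = T a b) ->
  (forall b, T i b = \sum_v c v * S v i b) ->
  deflated_char_poly T = \sum_v c v *: deflated_char_poly (S v).
Proof.
move=> c1 S_off T_row.
rewrite /deflated_char_poly (char_poly_row_affine c1 S_off T_row).
rewrite (big_morph _ (@divpD _ _) (div0p _)).
by apply: eq_bigr => v _; rewrite divpZl.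
Qed.

(** If all the ratios with [c i] and [D i] positive were above the mediant [k],
    all the terms [c i * (N i - k * D i)] would be nonnegative, and positive at
    these indices; as they sum to 0 there would be no such index, and the
    denominator of [k] would vanish.  The sign condition on [N i] covers the
    indices where [D i = 0]. *)
Lemma exists_ratio_le_mediant (R : realFieldType) (I : finType)
    (c N D : I -> R) :
  (forall i, 0 <= c i) -> (forall i, 0 <= D i) ->
  (forall i, D i = 0 -> 0 <= N i) ->
  0 < \sum_i c i * D i ->
  exists i, [/\ 0 < c i, 0 < D i &
    N i / D i <= (\sum_i c i * N i) / (\sum_i c i * D i)].
Proof.
move=> c_ge0 D_ge0 N_ge0 D_gt0; set k := _ / _.
have [/existsP[i /and3P[]]|] :=
  boolP [exists i, [&& 0 < c i, 0 < D i & N i / D i <= k]]; first by exists i.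
move=> /existsPn/= above.
have above' i : 0 < c i -> 0 < D i -> 0 < N i - k * D i.
  move=> ci Di; have := above i; rewrite ci Di /= -ltNge ltr_pdivlMr //.
  by rewrite subr_gt0.
have term_ge0 i : 0 <= c i * (N i - k * D i).
  have := c_ge0 i; rewrite le_eqVlt => /predU1P[<-|ci]; first by rewrite mul0r.
  rewrite mulr_ge0 //; have := D_ge0 i.
  rewrite le_eqVlt => /predU1P[/esym D0|Di]; last by rewrite ltW ?above'.
  by rewrite D0 mulr0 subr0 N_ge0.
have sum0 : \sum_i c i * (N i - k * D i) = 0.
  under eq_bigr do rewrite mulrBr mulrCA.
  by rewrite sumrB -mulr_sumr /k divfK ?subrr // gt_eqF.
have := D_gt0; rewrite big1 ?ltxx // => i _.
have term0 : c i * (N i - k * D i) = 0.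
  by apply: (psumr_eq0P _ sum0) => // j _; apply: term_ge0.
have := c_ge0 i; rewrite le_eqVlt => /predU1P[<-|ci]; first by rewrite mul0r.
have := D_ge0 i; rewrite le_eqVlt => /predU1P[<-|Di]; first by rewrite mulr0.
by move/eqP: term0; rewrite gt_eqF // mulr_gt0 // above'.
Qed.

(** * Vertex completions *)

Section Vertices.
Variables (R : realType) (n : nat) (P : 'M[option R]_n).
Hypothesis P_ps : partial_stochastic P.

(** When row [i] is fully specified, the missing mass is 0 and this is the
    specified row itself, whatever [v] is. *)
Definition vertex_row (i v j : 'I_n) : R :=
  odflt 0 (P i j) + (1 - specified_sum P i) * (j == v)%:R.

Definition vertex_completion (f : {ffun 'I_n -> 'I_n}) : 'M[R]_n :=
  \matrix_(i, j) vertex_row i (f i) j.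

Definition set_vertex_row (T : 'M[R]_n) (i v : 'I_n) : 'M[R]_n :=
  \matrix_(a, b) (if a == i then vertex_row i v b else T a b).

Let sum_pred1 (v : 'I_n) : \sum_j (j == v)%:R = 1 :> R.
Proof. by rewrite (bigD1 v) //= eqxx big1 ?addr0 // => j /negPf->. Qed.

Lemma vertex_row_ge0 i v j : 0 <= vertex_row i v j.
Proof.
rewrite addr_ge0 ?mulr_ge0 ?subr_ge0 ?(ps_sum_le1 P_ps) //.
by case E: (P i j) => [x|//=]; apply: (ps_ge0 P_ps E).
Qed.

Lemma vertex_row_sum i v : \sum_j vertex_row i v j = 1.
Proof.
by rewrite big_split /= -mulr_sumr sum_pred1 mulr1 -/(specified_sum P i) addrC subrK.
Qed.

Lemma set_vertex_row_stochastic T i v : stochastic T -> stochastic (set_vertex_row T i v).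
Proof.
case=> T_ge0 T_sum; split=> [a b|a].
  by rewrite mxE; case: ifP => _; rewrite ?vertex_row_ge0.
under eq_bigr do rewrite mxE.
by case: (a == i); rewrite ?vertex_row_sum.
Qed.

Lemma set_vertex_row_completion T i v :
  completion P T -> fully_specified P i || (P i v == None) ->
  completion P (set_vertex_row T i v).
Proof.
move=> T_compl v_ok a b x Pab.
rewrite mxE; case: ifP => [/eqP ai|_]; last exact: T_compl.
rewrite ai in Pab; rewrite /vertex_row Pab /=.
case/orP: v_ok => [/(ps_sum_full P_ps) ->|/eqP Pv].
  by rewrite subrr mul0r addr0.
by case: eqP => [bv|_]; [rewrite -bv Pab in Pv | rewrite mulr0 addr0].
Qed.

(** The weight of the vertex [v] is the share of the missing mass that T puts on
    the unspecified entry [v].  There is missing mass to divide by exactly when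
    the row is not fully specified; otherwise all vertices give the same row and
    any weights of sum 1 will do. *)
Lemma completion_row_combination T i :
  SC P T ->
  exists c : 'I_n -> R,
    [/\ forall v, 0 <= c v,
        \sum_v c v = 1,
        forall v, 0 < c v -> fully_specified P i || (P i v == None) &
        forall b, T i b = \sum_v c v * vertex_row i v b].
Proof.
move=> [T_compl [T_ge0 T_sum]].
have combo (c : 'I_n -> R) b : \sum_v c v = 1 ->
    \sum_v c v * vertex_row i v b
    = odflt 0 (P i b) + (1 - specified_sum P i) * c b.
  move=> c1; under eq_bigr do rewrite mulrDr.
  rewrite big_split -mulr_suml c1 mul1r /=; congr (_ + _).
  rewrite (bigD1 b) //= eqxx mulr1 mulrC big1 ?addr0 // => v vb.
  by rewrite eq_sym (negPf vb) !mulr0.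
have TE b : T i b = odflt 0 (P i b) + (if P i b == None then T i b else 0).
  by case E: (P i b) => [x|] /=; rewrite ?add0r // addr0; apply: T_compl.
have [full|not_full] := boolP (fully_specified P i).
  exists (fun v => (v == i)%:R); split=> [v||v|b]; rewrite ?ler0n ?sum_pred1 ?full //.
  rewrite combo ?sum_pred1 // (ps_sum_full P_ps full) subrr mul0r.
  rewrite TE; case: ifP => // Pb.
  by move: full; rewrite /fully_specified => /eqP/setP/(_ b); rewrite !inE Pb.
have s_neq0 : 1 - specified_sum P i != 0.
  by rewrite subr_eq0; apply: contra not_full => /eqP/esym/(ps_full P_ps).
have s_gt0 : 0 < 1 - specified_sum P i.
  by rewrite lt_def s_neq0 subr_ge0 (ps_sum_le1 P_ps).
pose c v := (if P i v == None then T i v else 0) / (1 - specified_sum P i).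
have c1 : \sum_v c v = 1.
  rewrite -mulr_suml; have := T_sum i.
  rewrite (eq_bigr _ (fun b _ => TE b)) big_split /= -/(specified_sum P i).
  by move/(canRL (addKr _)) ->; rewrite addrC mulfV.
exists c; split=> // [v|v|b].
- by rewrite divr_ge0 ?(ltW s_gt0) //; case: ifP.
- by rewrite /c; case: ifP => // _; rewrite mul0r ltxx.
by rewrite combo // /c mulrC divfK.
Qed.

End Vertices.

(** * Reduction to vertex completions *)

Section Reduction.
Variables (R : realType) (n : nat) (P : 'M[option R]_n.+1).
Hypothesis P_ps : partial_stochastic P.

(** At a vertex with positive weight and [q(1) > 0] the matrix remains a
    completion with a single essential class, and the mediant inequality compares
    the two Kemeny constants. *)
Lemma set_vertex_row_kemeny_le T i :
  SC P T -> single_essential_class T ->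
  exists v, [/\ SC P (set_vertex_row P T i v),
                single_essential_class (set_vertex_row P T i v) &
                kemeny (set_vertex_row P T i v) <= kemeny T].
Proof.
move=> T_SC; have [T_compl T_st] := T_SC.
move=> /(single_essential_class_deflated T_st) q1.
have [c [c_ge0 c1 c_ok T_row]] := completion_row_combination P_ps i T_SC.
pose S v := set_vertex_row P T i v.
have S_st v : stochastic (S v) by apply: set_vertex_row_stochastic.
have qE : deflated_char_poly T = \sum_v c v *: deflated_char_poly (S v).
  apply: (deflated_row_affine (i := i)) c1 _ _ => [v a b /negPf ai|b].
    by rewrite mxE ai.
  by rewrite T_row; apply: eq_bigr => v _; rewrite mxE eqxx.
have q1E : (deflated_char_poly T).[1]
    = \sum_v c v * (deflated_char_poly (S v)).[1].
  by rewrite qE horner_sum; apply: eq_bigr => v _; rewrite hornerZ.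
have q1'E : (deflated_char_poly T)^`().[1]
    = \sum_v c v * (deflated_char_poly (S v))^`().[1].
  by rewrite qE raddf_sum horner_sum; apply: eq_bigr => v _ /=; rewrite derivZ hornerZ.
have [|v [cv_gt0 Dv_gt0 ratio_le]] := exists_ratio_le_mediant c_ge0
    (fun v => deflated1_ge0 (S_st v)) (fun v => deriv_deflated1_ge0 (S_st v)).
  by rewrite -q1E lt_def q1 deflated1_ge0.
exists v; split.
- by split; [apply: set_vertex_row_completion (c_ok _ cv_gt0) | apply: S_st].
- by apply/(single_essential_class_deflated (S_st v)); rewrite gt_eqF.
rewrite (kemeny_deflated T_st q1) (kemeny_deflated (S_st v)) ?gt_eqF //.
by rewrite q1E q1'E.
Qed.

Lemma vertex_completion_kemeny_le T :
  SC P T -> single_essential_class T ->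
  exists f, [/\ SC P (vertex_completion P f),
                single_essential_class (vertex_completion P f) &
                kemeny (vertex_completion P f) <= kemeny T].
Proof.
move=> T_SC T_single.
have [f [T' [T'_SC T'_single T'_le T'_rows]]] :
    exists (f : {ffun 'I_n.+1 -> 'I_n.+1}) T',
    [/\ SC P T', single_essential_class T', kemeny T' <= kemeny T &
        forall i j, i \in enum 'I_n.+1 -> T' i j = vertex_row P i (f i) j].
  elim: (enum 'I_n.+1) => [|a s [f [T' [T'_SC T'_single T'_le T'_rows]]]].
    by exists [ffun=> ord0], T; split.
  have [v [S_SC S_single S_le]] := set_vertex_row_kemeny_le a T'_SC T'_single.
  exists [ffun i => if i == a then v else f i], (set_vertex_row P T' a v).
  split=> // [|i j]; first exact: le_trans S_le T'_le.
  rewrite inE mxE ffunE; case: eqP => [-> //|_ /=]; exact: T'_rows.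
exists f; have <- : T' = vertex_completion P f; last by [].
by apply/matrixP => i j; rewrite mxE T'_rows // mem_enum.
Qed.

End Reduction.

Theorem proposition2p4 (R : realType) (n : nat) (P : 'M[option R]_n)
  (P_ps : partial_stochastic P)
  (P_single : exists T : 'M[R]_n, SC P T /\ single_essential_class T) :
  exists T : 'M[R]_n,
    [/\ SC P T,
        single_essential_class T,
        kemeny T = kemeny_inf P &
        forall j : 'I_n,
          (#|[set k : 'I_n | (P j k == None) && (0 < T j k)%R]| <= 1)%N].
Proof.
case: n P P_ps P_single => [|n] P P_ps [T0 [T0_SC T0_single]].
  (* An empty matrix has no essential class. *)
  move: T0_single => /eqP/cards1P[C /setP/(_ C)].
  rewrite !inE eqxx => /and4P[/set0Pn[[]] //].
pose ok f := SC P (vertex_completion P f) /\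
             single_essential_class (vertex_completion P f).
have [f0 [f0_SC f0_single _]] := vertex_completion_kemeny_le P_ps T0_SC T0_single.
have f0_ok : `[< ok f0 >] by apply/asboolP.
have [f /asboolP[f_SC f_single] f_min] :=
  @arg_minP _ _ _ f0 [pred f | `[< ok f >]]
    (fun f => kemeny (vertex_completion P f)) f0_ok.
exists (vertex_completion P f); split=> //.
  have f_lb : lbound [set kemeny T | T in
      [set T : 'M[R]_n.+1 | SC P T /\ single_essential_class T]]%classic
      (kemeny (vertex_completion P f)).
    move=> _ [T [T_SC T_single] <-].
    have [g [g_SC g_single g_le]] :=
      vertex_completion_kemeny_le P_ps T_SC T_single.
    by apply: le_trans g_le; apply: f_min; apply/asboolP.
  apply/eqP; rewrite eq_le; apply/andP; split.
    apply: lb_le_inf => //.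
    by exists (kemeny (vertex_completion P f)), (vertex_completion P f).
  apply: ge_inf; first by exists (kemeny (vertex_completion P f)).
  by exists (vertex_completion P f).
move=> j; rewrite -(cards1 (f j)); apply/subset_leq_card/fintype.subsetP => k.
rewrite !inE mxE /vertex_row => /andP[/eqP -> /=].
by case: eqP => // _; rewrite mulr0 addr0 ltxx.
Qed.
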